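(* Let $p$ be a prime with $p\equiv-1\pmod 8$, and let $\mathcal{D}_1,\mathcal{D}_2,\mathcal{E}_1,\mathcal{E}_2$ be the quadratic residue codes of length $p$ over $R$ defined below. Then: (i) $\mathcal{D}_i\mu_a=\mathcal{D}_i$ and $\mathcal{E}_i\mu_a=\mathcal{E}_i$ for $i=1,2$ and $a\in\mathcal{Q}_p$; $\mathcal{D}_1\mu_a=\mathcal{D}_2$ and $\mathcal{E}_1\mu_a=\mathcal{E}_2$ for $a\in\mathcal{N}_p$; (ii) $\mathcal{D}_1\cap\mathcal{D}_2=(J(X))$ and $\mathcal{D}_1+\mathcal{D}_2=R_p$; (iii) $\mathcal{E}_1\cap\mathcal{E}_2=\{0\}$ and $\mathcal{E}_1+\mathcal{E}_2=(J(X))^\perp$; (iv) $|\mathcal{D}_1|=|\mathcal{D}_2|=4^{p+1}$ and $|\mathcal{E}_1|=|\mathcal{E}_2|=4^{p-1}$; (v) $\mathcal{D}_i=\mathcal{E}_i+(J(X))$ for $i=1,2$; (vi) $\mathcal{E}_1,\mathcal{E}_2$ are Euclidean self-orthogonal and $\mathcal{E}_i^\perp=\mathcal{D}_i$ for $i=1,2$.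
   Context: $R=\mathbb{Z}_4[v]/(v^2-v)$, $R_p=R[X]/(X^p-1)$, vectors of $R^p$ identified with elements of $R_p$; $(f)$ denotes the ideal (cyclic code) generated by $f$. $\mathcal{Q}_p$ is the set of nonzero quadratic residues mod $p$, $\mathcal{N}_p$ the set of quadratic non-residues. $Q(X)=\sum_{i\in\mathcal{Q}_p}X^i$, $N(X)=\sum_{i\in\mathcal{N}_p}X^i$, $J(X)=p\sum_{i=0}^{p-1}X^i$. For an integer $a$ coprime to $p$, $\mu_a$ maps $\sum_ic_iX^i\mapsto\sum_ic_iX^{ai}$ (exponents mod $p$), and $\mathcal{C}\mu_a$ is the image of $\mathcal{C}$. Euclidean dual $\mathcal{C}^\perp=\{\mathbf{x}:\sum_ix_ic_i=0\ \forall\mathbf{c}\in\mathcal{C}\}$; self-orthogonal means $\mathcal{C}\subseteq\mathcal{C}^\perp$. Case I ($p\equiv-1\pmod 8$), write $p+1=8r$. If $r$ is odd: $\mathcal{D}_1=(v(Q+2N)+(1-v)(N+2Q))$, $\mathcal{D}_2=(v(N+2Q)+(1-v)(Q+2N))$, $\mathcal{E}_1=(v(1-N+2Q)+(1-v)(1-Q+2N))$, $\mathcal{E}_2=(v(1-Q+2N)+(1-v)(1-N+2Q))$. If $r$ is even: $\mathcal{D}_1=(-vQ-(1-v)N)$, $\mathcal{D}_2=(-vN-(1-v)Q)$, $\mathcal{E}_1=(v(1+N)+(1-v)(1+Q))$, $\mathcal{E}_2=(v(1+Q)+(1-v)(1+N))$. *)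

(* Defs.v *)
From HB Require Import structures.
From mathcomp Require Import all_boot all_order all_algebra.
Set Implicit Arguments. Unset Strict Implicit. Unset Printing Implicit Defensive.
Import GRing.Theory.
Local Open Scope ring_scope.

(* ---------- The ring R = Z_4[v]/(v^2 - v) ---------- *)
(* An element (a, b) : R represents a + b v, with a b in Z_4 = 'Z_4. *)
Definition R : Type := ('Z_4 * 'Z_4)%type.
HB.instance Definition _ := GRing.Zmodule.on R.
HB.instance Definition _ := Finite.on R.

(* (a + b v)(c + d v) = ac + (ad + bc + bd) v, using v^2 = v *)
Definition Rmul (x y : R) : R :=
  (x.1 * y.1, x.1 * y.2 + x.2 * y.1 + x.2 * y.2).
Definition Rone : R := (1, 0).

Lemma RmulA : associative Rmul.
Proof.
move=> [a b] [c d] [e f].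
case: a => [[|[|[|[|//]]]] Ha]; case: b => [[|[|[|[|//]]]] Hb];
case: c => [[|[|[|[|//]]]] Hc]; case: d => [[|[|[|[|//]]]] Hd];
case: e => [[|[|[|[|//]]]] He]; case: f => [[|[|[|[|//]]]] Hf];
by apply/eqP.
Qed.

Lemma RmulC : commutative Rmul.
Proof.
move=> [a b] [c d]; rewrite /Rmul /= (mulrC c a) (mulrC c b) (mulrC d a) (mulrC d b).
by rewrite (addrC (b * c)).
Qed.

Lemma Rmul1 : left_id Rone Rmul.
Proof. by move=> [a b]; rewrite /Rmul /Rone /= !mul1r !mul0r !addr0. Qed.

Lemma RmulDl : left_distributive Rmul +%R.
Proof.
move=> [a b] [c d] [e f]; rewrite /Rmul /=.
apply: (@congr2 _ _ _ pair); rewrite /= !mulrDl //.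
by rewrite (addrACA (a * f)) (addrACA (a * f + b * e)).
Qed.

Lemma Rone_neq0 : Rone != 0.
Proof. by []. Qed.

HB.instance Definition _ :=
  GRing.Zmodule_isComNzRing.Build R RmulA RmulC Rmul1 RmulDl Rone_neq0.

Definition vR : R := (0, 1).

(* ---------- R_p = R[X]/(X^p - 1), identified with R^p ---------- *)
(* c : Rp p stands for \sum_i c i X^i *)
Notation Rp p := {ffun 'I_p -> R}.

Definition pmul (p : nat) (f g : Rp p) : Rp p :=
  [ffun k : 'I_p => \sum_(i < p) \sum_(j < p | ((i + j) %% p == k)%N) f i * g j].

Definition scal (p : nat) (c : R) (f : Rp p) : Rp p := [ffun i => c * f i].

Definition one_p (p : nat) : Rp p := [ffun i : 'I_p => if val i == 0%N then 1 else 0].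

Definition gen (p : nat) (f : Rp p) : {set Rp p} := [set pmul g f | g : Rp p].

Definition isQR (p a : nat) : bool :=
  ((a %% p != 0)%N && [exists x : 'I_p, (x * x %% p == a %% p)%N]).
Definition isNR (p a : nat) : bool :=
  ((a %% p != 0)%N && ~~ [exists x : 'I_p, (x * x %% p == a %% p)%N]).

Definition Qp (p : nat) : Rp p := [ffun i : 'I_p => if isQR p i then 1 else 0].
Definition Np (p : nat) : Rp p := [ffun i : 'I_p => if isNR p i then 1 else 0].
Definition Jp (p : nat) : Rp p := [ffun _ : 'I_p => p%:R].

Definition mu (p a : nat) (c : Rp p) : Rp p :=
  [ffun j : 'I_p => \sum_(i < p | (a * i %% p == j)%N) c i].
Definition muS (p a : nat) (C : {set Rp p}) : {set Rp p} := [set mu a c | c in C].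

Definition dual (p : nat) (C : {set Rp p}) : {set Rp p} :=
  [set x : Rp p | [forall c in C, \sum_(i < p) x i * c i == 0]].
Definition sumC (p : nat) (C1 C2 : {set Rp p}) : {set Rp p} :=
  [set z : Rp p | [exists x in C1, exists y in C2, z == x + y]].

Definition D1 (p : nat) : {set Rp p} :=
  if odd ((p + 1) %/ 8) then
    gen (scal vR (Qp p + Np p *+ 2) + scal (1 - vR) (Np p + Qp p *+ 2))
  else gen (- scal vR (Qp p) - scal (1 - vR) (Np p)).
Definition D2 (p : nat) : {set Rp p} :=
  if odd ((p + 1) %/ 8) then
    gen (scal vR (Np p + Qp p *+ 2) + scal (1 - vR) (Qp p + Np p *+ 2))
  else gen (- scal vR (Np p) - scal (1 - vR) (Qp p)).
Definition E1 (p : nat) : {set Rp p} :=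
  if odd ((p + 1) %/ 8) then
    gen (scal vR (one_p p - Np p + Qp p *+ 2) + scal (1 - vR) (one_p p - Qp p + Np p *+ 2))
  else gen (scal vR (one_p p + Np p) + scal (1 - vR) (one_p p + Qp p)).
Definition E2 (p : nat) : {set Rp p} :=
  if odd ((p + 1) %/ 8) then
    gen (scal vR (one_p p - Qp p + Np p *+ 2) + scal (1 - vR) (one_p p - Np p + Qp p *+ 2))
  else gen (scal vR (one_p p + Qp p) + scal (1 - vR) (one_p p + Np p)).

(* Main.v *)
Require Import Defs.
From HB Require Import structures.
From mathcomp Require Import all_boot all_order all_algebra cyclic.
From mathcomp Require Import ring zify.
Set Implicit Arguments. Unset Strict Implicit. Unset Printing Implicit Defensive.
Import GRing.Theory.
Local Open Scope ring_scope.

(* Write p = 8r - 1 and let q, q' be the two generators over Z_4: -Q, -N for r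
   even, Q + 2N, N + 2Q for r odd.  From Q^2 = (2r-1) Q + 2r N they are
   idempotents with q q' = J and q + q' = 1 + J, and so are their combinations
   d1 = v q + (1-v) q' and d2 = v q' + (1-v) q.  The codes are D1 = (d1),
   D2 = (d2), E1 = (1 - d2), E2 = (1 - d1), so everything follows from the
   calculus of ideals generated by idempotents in R_p: sums and intersections
   have generators d + d' - d d' and d d', the multiplier mu_a maps (d) to
   (mu_a d), and (d)^perp = (1 - mu_{-1} d), where mu_{-1} exchanges d1 and d2
   because -1 is a non-residue.  The cardinalities come from
   |D1| = |E1| |(J)|, |D1| |E2| = |R_p| and |E1| = |E2|. *)

(** * The ring R[X]/(X^p - 1) *)

(** Exponents live in the additive group ['I_n.+1], where i + j = k leaves only j = k - i in the
    inner sum: the product is a cyclic convolution. *)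
Lemma pmulE n (f g : Rp n.+1) (k : 'I_n.+1) :
  pmul f g k = \sum_i f i * g (k - i).
Proof.
rewrite ffunE; apply: eq_bigr => i _.
rewrite (big_pred1 (k - i)) // => j /=.
by rewrite -[LHS]/(i + j == k) eq_sym [RHS]eq_sym subr_eq addrC.
Qed.

Lemma pmulC n : commutative (@pmul n.+1).
Proof.
move=> f g; apply/ffunP=> k; rewrite !pmulE.
rewrite (reindex_inj (inv_inj (subKr k))).
by apply: eq_bigr => i _; rewrite subKr mulrC.
Qed.

Lemma pmulA n : associative (@pmul n.+1).
Proof.
move=> f g h; apply/ffunP=> k; rewrite !pmulE.
under eq_bigr => i _ do rewrite pmulE mulr_sumr.
under [RHS]eq_bigr => i _ do rewrite pmulE mulr_suml.
rewrite [RHS]exchange_big; apply: eq_bigr => i _ /=.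
rewrite (reindex_inj (addIr (- i))).
apply: eq_bigr => j _.
by rewrite mulrA opprB addrA subrK.
Qed.

Lemma pmul1 n : left_id (one_p n.+1) (@pmul n.+1).
Proof.
move=> f; apply/ffunP=> k; rewrite pmulE (bigD1 0) //= big1 => [|i i0].
  by rewrite ffunE /= mul1r subr0 addr0.
by rewrite ffunE -(inj_eq val_inj) /= in i0 *; rewrite (negbTE i0) mul0r.
Qed.

Lemma pmulDl n : left_distributive (@pmul n.+1) +%R.
Proof.
move=> f g h; apply/ffunP=> k; rewrite pmulE [RHS]ffunE !pmulE -big_split.
by apply: eq_bigr => i _; rewrite ffunE mulrDl.
Qed.

(* An alias, because {ffun 'I_n.+1 -> R} already carries the pointwise product. *)
Definition cyc n : Type := Rp n.+1.
HB.instance Definition _ n := GRing.Zmodule.on (cyc n).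
HB.instance Definition _ n := Finite.on (cyc n).
HB.instance Definition _ n := GRing.Zmodule_isComPzRing.Build (cyc n)
  (@pmulA n) (@pmulC n) (@pmul1 n) (@pmulDl n).

(** * Codes generated by an idempotent *)

Section CyclicCodes.
Variable n : nat.
Implicit Types (a b e f g x : cyc n) (C : {set Rp n.+1}).

(** When e is idempotent, every multiple of e is fixed by multiplication by e, so membership becomes
    an equation. *)
Lemma mem_gen e x : e * e = e -> (x \in gen e) = (x * e == x).
Proof.
move=> ee; apply/imsetP/eqP=> [[g _ ->]|xe]; last by exists x.
by rewrite -[pmul g e]/((g : cyc n) * e) -mulrA ee.
Qed.

Lemma mem_sumC (C1 C2 : {set Rp n.+1}) (z : Rp n.+1) :
  reflect (exists x y, [/\ x \in C1, y \in C2 & z = x + y]) (z \in sumC C1 C2).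
Proof.
rewrite inE; apply: (iffP exists_inP) => [[x xC /exists_inP[y yC /eqP->]]|].
  by exists x, y.
by case=> x [y [xC yC ->]]; exists x => //; apply/exists_inP; exists y.
Qed.

Lemma genI a b : a * a = a -> b * b = b -> gen a :&: gen b = gen (a * b).
Proof.
move=> aa bb; have abab : (a * b) * (a * b) = a * b by rewrite mulrACA aa bb.
apply/setP=> x; rewrite inE !mem_gen //.
apply/andP/eqP=> [[/eqP xa /eqP xb]|xab]; first by rewrite mulrA xa.
split; apply/eqP; rewrite -{1}xab.
  by rewrite -mulrA [a * b * a]mulrAC aa.
by rewrite -2!mulrA bb.
Qed.

(** Since 1 - (a + b - ab) = (1 - a)(1 - b), the element a + b - ab acts as the identity on both
    ideals. *)
Lemma sumC_gen a b : a * a = a -> b * b = b ->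
  sumC (gen a) (gen b) = gen (a + b - a * b).
Proof.
move=> aa bb; set c := a + b - a * b.
have ac : a * c = a.
  by rewrite /c mulrBr mulrDr mulrA aa addrK.
have bc : b * c = b.
  by rewrite /c mulrBr mulrDr bb mulrCA bb [b * a]mulrC addrAC subrr add0r.
have cc : c * c = c by rewrite {1}/c mulrBl mulrDl -mulrA ac bc.
apply/setP=> z; rewrite mem_gen //.
apply/mem_sumC/eqP=> [[x [y []]]|zc].
  rewrite !mem_gen // => /eqP xa /eqP yb ->.
  by rewrite mulrDl -xa -yb -!mulrA ac bc.
exists ((z : cyc n) * a), ((z : cyc n) * (b - a * b)); split; last first.
- by rewrite -[LHS]zc /c -addrA; apply: (@mulrDr (cyc n)).
- by rewrite mem_gen // -mulrA mulrBl -mulrA bb.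
- by rewrite mem_gen // -mulrA aa.
Qed.

(** Orthogonality makes the sum direct: multiplying u + w by a gives back u, and by b gives back
    w. *)
Lemma card_gen_add a b : a * a = a -> b * b = b -> a * b = 0 ->
  #|gen (a + b)| = (#|gen a| * #|gen b|)%N.
Proof.
move=> aa bb ab0.
have -> : gen (a + b) = (fun xy : Rp n.+1 * Rp n.+1 => xy.1 + xy.2) @: setX (gen a) (gen b).
  rewrite -[a + b]subr0 -ab0 -sumC_gen //.
  apply/setP=> z; apply/mem_sumC/imsetP=> [[x [y [xa yb ->]]]|].
    by exists (x, y); rewrite // in_setX xa.
  by case=> -[x y]; rewrite in_setX => /andP[xa yb] ->; exists x, y.
rewrite card_in_imset ?cardsX // => -[x y] [x' y'].
rewrite !in_setX !mem_gen //= => /andP[/eqP xa /eqP yb] /andP[/eqP xa' /eqP yb'].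
have ann (u w : cyc n) : u * a = u -> w * b = w ->
    (u + w) * a = u /\ (u + w) * b = w.
  move=> ua wb; rewrite !mulrDl ua wb -wb -ua -!mulrA ab0 [b * a]mulrC ab0 !mulr0.
  by rewrite addr0 add0r.
move=> /= eq_s.
have [sx sy] := ann _ _ xa yb; have [sx' sy'] := ann _ _ xa' yb'.
congr (_, _).
  by apply: etrans (esym sx) _; rewrite -[RHS]sx'; apply: (congr1 ( *%R^~ a)).
by apply: etrans (esym sy) _; rewrite -[RHS]sy'; apply: (congr1 ( *%R^~ b)).
Qed.

End CyclicCodes.

Lemma subset_gen n (e f : cyc n) : e * e = e -> f * f = f -> e * f = e ->
  gen e \subset gen f.
Proof.
move=> ee ff ef; apply/subsetP=> x; rewrite !mem_gen // => /eqP xe.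
by rewrite -xe -mulrA ef.
Qed.

Lemma R_mulr4n (c : R) : c *+ 4 = 0.
Proof. by case: c => [[[|[|[|[|//]]]] Ha] [[|[|[|[|//]]]] Hb]]; apply/eqP. Qed.

Lemma cyc_mulr4n n (f : cyc n) : f *+ 4 = 0.
Proof. by apply/ffunP=> i; rewrite [LHS]ffunMnE R_mulr4n ffunE. Qed.

(** The form in which p = 8r - 1 and (p - 1)/2 = 4r - 1 both become -1. *)
Lemma natr_pred4 (A : pzRingType) t : (forall x : A, x *+ 4 = 0) -> (0 < t)%N ->
  (4 * t - 1)%:R = -1 :> A.
Proof.
by move=> A4 t0; rewrite natrB ?muln_gt0 // natrM mulr_natl A4 sub0r.
Qed.

Lemma mulrn_pred4 n (f : cyc n) t : (0 < t)%N -> f *+ (4 * t - 1) = - f.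
Proof. by move=> t0; rewrite mulrnBr ?muln_gt0 // mulrnA cyc_mulr4n mul0rn sub0r. Qed.

Lemma mulrn_add4 n (f : cyc n) t u : f *+ (4 * t + u) = f *+ u.
Proof. by rewrite mulrnDr mulrnA cyc_mulr4n mul0rn add0r. Qed.

(** As -2 = 2 modulo 4, the complement of Q + 2N takes the shape 1 - Q + 2N found in the generators
    of [E1] and [E2]. *)
Lemma subrD2 n (f g : cyc n) : 1 - (f + g *+ 2) = 1 - f + g *+ 2.
Proof.
transitivity (1 - f + g *+ 2 - g *+ 4); first ring.
by rewrite cyc_mulr4n subr0.
Qed.

(** Turns scalars into constant polynomials, so that identities involving v become plain ring
    identities. *)
Lemma scal_mul n (c : R) (f : cyc n) : scal c f = (scal c (1 : cyc n) : cyc n) * f.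
Proof.
apply/ffunP=> i; rewrite [RHS]pmulE ffunE -[f in LHS]mul1r [in LHS]pmulE mulr_sumr.
by apply: eq_bigr => j _; rewrite [scal _ _ _]ffunE mulrA.
Qed.

(** * Multipliers and duality *)

Section Multipliers.
Variables (k a : nat).
Hypothesis ua : (a%:R : 'Z_k.+2) \is a GRing.unit.
Implicit Types (f g : cyc k.+1) (i j : 'Z_k.+2).

(** A unit a permutes the exponents, so the sum defining [mu] has a single term. *)
Lemma mu_val f i : mu a f (a%:R * i) = f i.
Proof.
rewrite ffunE (big_pred1 i) // => j /=.
rewrite -(inj_eq (mulrI ua)) -(inj_eq val_inj) /=; congr (_ == _).
by rewrite (val_Zp_nat (isT : 1 < k.+2)%N) modnMml.
Qed.

Lemma muP f (g : Rp k.+2) : (forall i, g (a%:R * i) = f i) -> mu a f = g.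
Proof.
by move=> fg; apply/ffunP=> j; rewrite -[j](mulVKr ua) mu_val fg.
Qed.

Lemma muM f g : mu a (f * g) = (mu a f : cyc _) * mu a g.
Proof.
apply: muP => i; rewrite [LHS]pmulE [RHS]pmulE (reindex_inj (mulrI ua)).
by apply: eq_bigr => j _ /=; rewrite -mulrBr !mu_val.
Qed.

Lemma muD f g : mu a (f + g) = (mu a f : cyc _) + mu a g.
Proof. by apply: muP => i; rewrite [LHS]ffunE [RHS]ffunE !mu_val. Qed.

Lemma muN f : mu a (- f) = - (mu a f : cyc _).
Proof. by apply: muP => i; rewrite [LHS]ffunE [RHS]ffunE mu_val. Qed.

Lemma muMn f t : mu a (f *+ t) = (mu a f : cyc _) *+ t.
Proof.
apply: muP => i; rewrite [RHS]ffunMnE -(mu_val f).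
by apply: etrans (ffunMnE _ _ _) _; rewrite mu_val.
Qed.

Lemma mu_inj : injective (@mu k.+2 a).
Proof. by move=> f g fg; apply/ffunP=> i; rewrite -[LHS]mu_val fg mu_val. Qed.

Lemma muS_gen f : muS a (gen f) = gen (mu a f).
Proof.
apply/setP=> x; apply/imsetP/imsetP=> [[_ /imsetP[g _ ->] ->]|[h _ ->]].
  by exists (mu a g); rewrite // [LHS]muM.
have muK : mu a [ffun i : 'Z_k.+2 => h (a%:R * i)] = h.
  by apply: muP => i; rewrite ffunE.
exists (pmul [ffun i : 'Z_k.+2 => h (a%:R * i)] f); first exact: imset_f.
by rewrite [RHS]muM muK.
Qed.

End Multipliers.

(** A surjective multiplicative map preserves the unit element. *)
Lemma mu1 k a : (a%:R : 'Z_k.+2) \is a GRing.unit ->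
  mu a (1 : cyc k.+1) = (1 : cyc k.+1).
Proof.
move=> ua; have [f f1] : exists f : cyc k.+1, mu a f = (1 : cyc k.+1).
  exists [ffun i : 'Z_k.+2 => (1 : cyc k.+1) (a%:R * i)].
  by apply: muP => // i; rewrite [RHS]ffunE.
by rewrite -[RHS]f1 -[f]mul1r muM // f1 mulr1.
Qed.

Lemma mu_scal k a c (f : cyc k.+1) : (a%:R : 'Z_k.+2) \is a GRing.unit ->
  mu a (scal c f) = scal c (mu a f).
Proof.
by move=> ua; apply: muP => // i; rewrite [LHS]ffunE [RHS]ffunE mu_val.
Qed.

(** [mu] is indexed by natural numbers, and k + 1 = p - 1 is the one that stands for -1. *)
Lemma natr_predZ k : (k.+1%:R : 'Z_k.+2) = -1.
Proof. by apply/eqP; rewrite -addr_eq0 natr1 char_Zp. Qed.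

Lemma unit_predZ k : (k.+1%:R : 'Z_k.+2) \is a GRing.unit.
Proof. by rewrite natr_predZ unitrN1. Qed.

Lemma mem_dual p (C : {set Rp p}) (x : Rp p) :
  reflect (forall c, c \in C -> \sum_i x i * c i = 0) (x \in dual C).
Proof.
rewrite inE; apply: (iffP forall_inP) => xC c /xC; first by move/eqP.
by move->.
Qed.

(* The inner product of x with g * e is the inner product of g with
   x * mu_{-1} e. *)
Lemma dual_gen k (e : cyc k.+1) : e * e = e ->
  dual (gen e) = gen (1 - (mu k.+1 e : cyc k.+1)).
Proof.
set e' : cyc k.+1 := mu k.+1 e => ee.
have e'e' : e' * e' = e' by rewrite -muM ?ee // unit_predZ.
have oe' : (1 - e') * (1 - e') = 1 - e'.
  by rewrite mulrBr mulr1 mulrBl mul1r e'e' subrr subr0.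
have adj (x g : cyc k.+1) :
    \sum_i x i * (g * e) i = \sum_i g i * (x * e') i.
  under eq_bigr => i _ do rewrite [X in _ * X]pmulE mulr_sumr.
  under [RHS]eq_bigr => i _ do rewrite [X in _ * X]pmulE mulr_sumr.
  rewrite exchange_big; apply: eq_bigr => j _; apply: eq_bigr => i _ /=.
  rewrite mulrCA; congr (_ * (_ * _)).
  by rewrite /e' -(mu_val (unit_predZ k)) natr_predZ mulN1r opprB.
have annE (x : cyc k.+1) : (x * (1 - e') == x) = (x * e' == 0).
  by rewrite mulrBr mulr1 -subr_eq0 addrAC subrr add0r oppr_eq0.
apply/setP=> x; rewrite mem_gen // annE.
apply/mem_dual/eqP=> [xd|xe c /imsetP[g _ ->]].
  (* Testing x against the codeword X^i e isolates the coefficient of X^i in x e'. *)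
  apply/ffunP=> i; pose d : cyc k.+1 := [ffun j => (j == i)%:R].
  have /xd : pmul d e \in gen e by apply: imset_f.
  rewrite [X in X = _ -> _](adj x d) (bigD1 i) //= big1 => [|j ji].
    by rewrite ffunE eqxx mul1r addr0 => ->; rewrite ffunE.
  by rewrite ffunE (negbTE ji) mul0r.
rewrite [LHS](adj x g) big1 // => i _.
by rewrite xe ffunE mulr0.
Qed.

(** * Quadratic residues modulo p = k + 2 *)

Section Residues.
Variable k : nat.
Hypothesis pr_p : prime k.+2.
Hypothesis p7 : (k.+2 %% 8 = 7)%N.
Let m := k.+1./2.
Let r := ((k.+2 + 1) %/ 8)%N.
Implicit Types (x y z i j : 'Z_k.+2).

Let rE : k.+2 = (8 * r - 1)%N. Proof. rewrite /r; lia. Qed.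
Let mE : m = (4 * r - 1)%N. Proof. rewrite /m; lia. Qed.
Let r_gt0 : (0 < r)%N. Proof. rewrite /r; lia. Qed.

Lemma unitZp_prime x : (x \is a GRing.unit) = (x != 0).
Proof.
rewrite -[x in LHS]natr_Zp unitZpE // prime_coprime //.
rewrite -(inj_eq val_inj) /=; congr (~~ _); apply/idP/eqP => [|->//].
case: (val x) (ltn_ord x) => // s sp /(dvdn_leq (ltn0Sn _)) ps.
by have := leq_trans sp ps; rewrite ltnn.
Qed.

Lemma Zp_fermat x : x != 0 -> x ^+ k.+1 = 1.
Proof.
rewrite -unitZp_prime -[x]natr_Zp unitZpE // => co.
rewrite -natrX; apply: val_inj; rewrite /= !val_Zp_nat //.
by move: co; rewrite coprime_sym => /Euler_exp_totient; rewrite totient_prime.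
Qed.

Lemma Zp_sqr1 x : x * x = 1 -> x = 1 \/ x = -1.
Proof.
move=> xx; have /eqP: (x - 1) * (x + 1) = 0 by rewrite -subr_sqr expr2 xx expr1n subrr.
have [x1 _|] := eqVneq (x - 1) 0; first by left; apply/eqP; rewrite -subr_eq0 x1.
rewrite -unitZp_prime => /mulrI inj /eqP x0; right; apply/eqP.
by rewrite -addr_eq0; apply/eqP/inj; rewrite x0 mulr0.
Qed.

Lemma N1_neq1 : (-1 : 'Z_k.+2) != 1.
Proof. by rewrite eq_sym -addr_eq0 -(inj_eq val_inj) /=; move: p7; case: k => // -[]. Qed.

(** As p is 3 modulo 4, the Euler exponent is odd; this is what makes -1 a non-residue. *)
Lemma odd_m : odd m. Proof. by rewrite mE; lia. Qed.

Lemma m_double : k.+1 = m.*2. Proof. by rewrite mE; lia. Qed.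

(* The Legendre symbol, by Euler's criterion; it takes values in Z_p. *)
Definition leg x := x ^+ m.

Lemma leg0 : leg 0 = 0. Proof. by rewrite /leg expr0n; case: m odd_m. Qed.
Lemma legM x y : leg (x * y) = leg x * leg y. Proof. exact: exprMn. Qed.
Lemma legN x : leg (- x) = - leg x.
Proof. by rewrite /leg exprNn -signr_odd odd_m mulN1r. Qed.

Lemma leg_neq0 x : x != 0 -> leg x = 1 \/ leg x = -1.
Proof.
by move=> x0; apply: Zp_sqr1; rewrite -exprD addnn -m_double Zp_fermat.
Qed.

Lemma legV x : x != 0 -> leg x^-1 = leg x.
Proof.
move=> x0; rewrite /leg exprVn -/(leg x).
by case: (leg_neq0 x0) => ->; rewrite ?invrN1 ?invr1.
Qed.

Lemma isQR_leg a : isQR k.+2 a = (leg a%:R == 1).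
Proof.
have val_a : val (a%:R : 'Z_k.+2) = (a %% k.+2)%N by exact: val_Zp_nat.
rewrite /isQR -val_a -[0%N]/(val (0 : 'Z_k.+2)) (inj_eq val_inj).
have [->|a0] := eqVneq (a%:R : 'Z_k.+2) 0; first by rewrite leg0.
apply/existsP/eqP => [[y /eqP yy_val]|la].
  have yy : (y : 'Z_k.+2) * y = a%:R by apply: val_inj.
  have y0 : y != 0 :> 'Z_k.+2 by apply: contraNneq a0 => y0; rewrite -yy y0 mul0r.
  by rewrite -yy legM; case: (leg_neq0 y0) => ->; rewrite ?mulrNN mulr1.
(* Because m is odd, a^((m+1)/2) is defined, and its square is a * a^m = a. *)
exists (a%:R ^+ m.+1./2 : 'Z_k.+2); apply/eqP; set y := _ ^+ _.
suff yy : y * y = a%:R by exact: (congr1 val yy).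
by rewrite /y -exprD addnn even_halfK /= ?negbK ?odd_m // exprS -/(leg _) la mulr1.
Qed.

Lemma isNR_leg a : isNR k.+2 a = (leg a%:R == -1).
Proof.
have val_a : val (a%:R : 'Z_k.+2) = (a %% k.+2)%N by exact: val_Zp_nat.
have -> : isNR k.+2 a = ((a %% k.+2 != 0)%N && ~~ isQR k.+2 a).
  by rewrite /isQR /isNR; case: (_ != _).
rewrite isQR_leg -val_a -[0%N]/(val (0 : 'Z_k.+2)) (inj_eq val_inj).
have [->|a0] := eqVneq (a%:R : 'Z_k.+2) 0.
  by rewrite leg0 [RHS]eq_sym oppr_eq0 oner_eq0.
by case: (leg_neq0 a0) => ->; rewrite eqxx ?(negbTE N1_neq1) // [RHS]eq_sym (negbTE N1_neq1).
Qed.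

Lemma legP x : [\/ x = 0, leg x = 1 | leg x = -1].
Proof.
have [->|/leg_neq0[]] := eqVneq x 0; first by constructor 1.
  by constructor 2.
by constructor 3.
Qed.

(** * Counting the ways to write x as a sum of two residues *)

Definition pairs (s t x : 'Z_k.+2) : {set 'Z_k.+2} :=
  [set i | (leg i == s) && (leg (x - i) == t)].
Arguments pairs (s t x)%_ring_scope.

(** Signs are coded as (-1)^s, so that [false] and [true] handle residues and non-residues with one
    statement. *)
Lemma leg_pm1 (s : bool) x : leg x = (-1) ^+ s -> x != 0.
Proof.
by apply: contra_eq_neq => ->; rewrite leg0 eq_sym signr_eq0.
Qed.

(** Negation exchanges residues and non-residues, which together make up the p - 1 = 2m nonzero
    classes. *)
Lemma card_leg (s : bool) : #|[set i : 'Z_k.+2 | leg i == (-1) ^+ s]| = m.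
Proof.
pose L t := [set i : 'Z_k.+2 | leg i == t].
have LN : #|L 1| = #|L (-1)|.
  rewrite -(card_imset _ oppr_inj); apply: eq_card => i.
  rewrite -[i]opprK mem_imset ?inE; last exact: oppr_inj.
  by rewrite legN opprK eqr_oppLR.
have : (#|L 1| + #|L (-1)|).+1 = m.*2.+1.
  rewrite -m_double -[RHS](card_ord k.+2).
  rewrite -(cardsC [set (0 : 'Z_k.+2)]) cards1 add1n -cardsUI.
  rewrite (_ : L 1 :&: L (-1) = set0) ?cards0 ?addn0.
    congr _.+1; apply: eq_card => i; rewrite !inE.
    have [->|/leg_neq0[]->] := eqVneq i 0; last 2 first.
    - by rewrite eqxx.
    - by rewrite eqxx orbT.
    by rewrite leg0 ![0 == _]eq_sym oppr_eq0 oner_eq0.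
  apply/setP=> i; rewrite !inE; apply/negP=> /andP[/eqP-> ].
  by rewrite eq_sym (negbTE N1_neq1).
rewrite LN addnn => -[/double_inj LNm].
by case: s; rewrite ?expr1 ?expr0 -/(L _) ?LN.
Qed.

(** The m elements i of the given symbol are sorted by the symbol of x - i; the last term counts i =
    x, where that symbol is 0. *)
Lemma card_split (s : bool) x :
  m = (#|pairs ((-1) ^+ s) 1 x| + #|pairs ((-1) ^+ s) (-1) x|
       + (leg x == (-1) ^+ s)%R)%N.
Proof.
rewrite -(card_leg s) -cardsUI (_ : _ :&: _ = set0) ?cards0 ?addn0; last first.
  apply/setP=> i; rewrite !inE; apply/negP=> /andP[/andP[_ /eqP->]].
  by rewrite [1 == _]eq_sym (negbTE N1_neq1) andbF.
rewrite -(cardsID [set x]) addnC; congr addn.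
  apply: eq_card => i; rewrite !inE -andb_orr -subr_eq0 -opprB oppr_eq0 andbC.
  congr andb; case: (legP (x - i)) => [->|l|l].
  - by rewrite leg0 eqxx ![0 == _]eq_sym oppr_eq0 oner_eq0.
  - by rewrite l eqxx (@leg_pm1 false).
  - by rewrite l eqxx orbT (@leg_pm1 true).
have [lx|lx] := boolP (_ == _).
  rewrite (_ : _ :&: _ = [set x]) ?cards1 //; apply/setP=> i; rewrite !inE.
  by have [->|] := eqVneq i x; rewrite ?lx ?andbF.
rewrite (_ : _ :&: _ = set0) ?cards0 //; apply/setP=> i; rewrite !inE.
by have [->|] := eqVneq i x; rewrite ?(negbTE lx) ?andbF.
Qed.

(* i |-> x^2 / i keeps leg i and, as x - x^2 / i = - x (x - i) / i,
   negates leg (x - i) when leg i = leg x = 1. *)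
Lemma card_pairs_QR x : leg x = 1 -> #|pairs 1 1 x| = #|pairs 1 (-1) x|.
Proof.
move=> lx; have x0 : x != 0 by apply: (@leg_pm1 false).
have xu : x * x \is a GRing.unit by rewrite unitrMr unitZp_prime.
have phi_inj : injective (fun i => x * x * i^-1).
  by move=> i j /(mulrI xu)/invr_inj.
have le t : (#|pairs 1 t x| <= #|pairs 1 (- t) x|)%N.
  rewrite -(card_imset _ phi_inj) subset_leq_card //.
  apply/subsetP=> _ /imsetP[i + ->]; rewrite !inE => /andP[/eqP li /eqP lxi].
  have i0 : i != 0 by apply: (@leg_pm1 false).
  rewrite !legM lx legV // li !mul1r eqxx /=.
  have -> : x - x * x * i^-1 = - (x * ((x - i) * i^-1)).
    rewrite mulrBl divrr ?unitZp_prime // mulrBr mulr1 opprB -mulrA.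
    by [].
  by rewrite legN !legM legV // lx lxi li mulr1 mul1r.
by apply/eqP; rewrite eqn_leq le; have := le (-1); rewrite opprK.
Qed.

(** These counts are the coefficients of Q^2. For a residue x, [card_split] and [card_pairs_QR] give
    4r - 1 = 2 #|pairs 1 1 x| + 1. A non-residue x is carried to the residue -x by negation. For x =
    0, both i and -i would have to be residues. *)
Lemma card_pairs1 x :
  #|pairs 1 1 x| = if leg x == 1 then (2 * r - 1)%N
                   else if leg x == -1 then (2 * r)%N else 0%N.
Proof.
have cQ y : leg y = 1 -> #|pairs 1 1 y| = (2 * r - 1)%N.
  move=> ly.
  have : m = (#|pairs 1 1 y| + #|pairs 1 (-1) y| + (leg y == 1)%R)%N.
    exact: card_split false y.
  by rewrite -card_pairs_QR // ly eqxx mE; lia.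
case: ifPn => [/eqP/cQ//|lx1]; case: ifPn => [/eqP lx|lxN1]; last first.
  case: (legP x) => [->|lx|lx]; last 2 first.
  - by rewrite lx eqxx in lx1.
  - by rewrite lx eqxx in lxN1.
  apply/eqP; rewrite cards_eq0; apply/eqP/setP=> i; rewrite !inE sub0r legN.
  by apply/negP=> /andP[/eqP->]; rewrite (negbTE N1_neq1).
have lNx : leg (- x) = 1 by rewrite legN lx opprK.
have -> : #|pairs 1 1 x| = #|pairs (-1) (-1) (- x)|.
  rewrite -(card_imset _ oppr_inj); apply: eq_card => i.
  rewrite -[i]opprK mem_imset ?inE; last exact: oppr_inj.
  by rewrite -opprD !legN opprK !eqr_opp.
(* The reflection i -> -x - i swaps the two summands, which reduces this to the residue case at -x;
   [card_split] then leaves 2r for the set wanted. *)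
have C : #|pairs (-1) 1 (- x)| = (2 * r - 1)%N.
  pose phi i := - x - i; have phiK : involutive phi := subKr (- x).
  rewrite -(cQ _ lNx) card_pairs_QR // -(card_imset _ (inv_inj phiK)).
  apply: eq_card => i; rewrite -[i]phiK mem_imset ?inE; last exact: inv_inj.
  by rewrite /phi !subKr andbC.
have : m = (#|pairs (-1) 1 (- x)| + #|pairs (-1) (-1) (- x)|
            + (leg (- x) == -1)%R)%N by exact: card_split true (- x).
by rewrite C lNx eq_sym (negbTE N1_neq1) mE; lia.
Qed.

(** * The products of Q, N and J *)

Lemma QpE (i : 'Z_k.+2) : Qp k.+2 i = (leg i == 1)%:R.
Proof. by rewrite ffunE isQR_leg // natr_Zp; case: (_ == _). Qed.

Lemma NpE (i : 'Z_k.+2) : Np k.+2 i = (leg i == -1)%:R.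
Proof. by rewrite ffunE isNR_leg // natr_Zp; case: (_ == _). Qed.

Lemma sqr_Qp : (Qp k.+2 : cyc _) * Qp k.+2 =
  (Qp k.+2 : cyc k.+1) *+ (2 * r - 1) + (Np k.+2 : cyc k.+1) *+ (2 * r).
Proof.
apply/ffunP=> x; rewrite [LHS]pmulE [RHS]ffunE.
have -> : ((Qp k.+2 : cyc k.+1) *+ (2 * r - 1)) x = Qp k.+2 x *+ (2 * r - 1).
  exact: ffunMnE.
have -> : ((Np k.+2 : cyc k.+1) *+ (2 * r)) x = Np k.+2 x *+ (2 * r).
  exact: ffunMnE.
under eq_bigr => i _ do rewrite !QpE -natrM mulnb.
rewrite -natr_sum -big_mkcond sum1dep_card -/(pairs 1 1 x) card_pairs1 QpE NpE.
have [->|_] := eqVneq; first by rewrite eq_sym (negbTE N1_neq1) mul0rn addr0.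
by case: eqP; rewrite ?mul0rn add0r.
Qed.

Lemma isQR_unit a : isQR k.+2 a -> (a%:R : 'Z_k.+2) \is a GRing.unit.
Proof. by rewrite isQR_leg unitZp_prime => /eqP/(@leg_pm1 false). Qed.

Lemma isNR_unit a : isNR k.+2 a -> (a%:R : 'Z_k.+2) \is a GRing.unit.
Proof. by rewrite isNR_leg unitZp_prime => /eqP/(@leg_pm1 true). Qed.

Lemma isNR_pred : isNR k.+2 k.+1.
Proof. by rewrite isNR_leg natr_predZ legN /leg expr1n eqxx. Qed.

Let Q : cyc k.+1 := Qp k.+2.
Let N : cyc k.+1 := Np k.+2.
Let J : cyc k.+1 := Jp k.+2.

Lemma mu_QR a : isQR k.+2 a -> mu a Q = Q /\ mu a N = N.
Proof.
move=> a_qr; have ua := isQR_unit a_qr; move: a_qr; rewrite isQR_leg => /eqP la.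
by split; apply: muP => // i; rewrite ?QpE ?NpE legM la mul1r.
Qed.

Lemma mu_NR a : isNR k.+2 a -> mu a Q = N /\ mu a N = Q.
Proof.
move=> a_nr; have ua := isNR_unit a_nr; move: a_nr; rewrite isNR_leg => /eqP la.
split; apply: muP => // i; rewrite QpE NpE legM la mulN1r; congr _%:R.
  by rewrite eqr_opp.
by rewrite eqr_oppLR.
Qed.

Lemma natr_p : k.+2%:R = -1 :> R.
Proof.
rewrite [X in X%:R](_ : _ = (4 * (2 * r) - 1))%N; last by rewrite mulnA -rE.
by rewrite (natr_pred4 R_mulr4n) ?muln_gt0.
Qed.

Lemma sumQN : 1 + Q + N = - J.
Proof.
apply/ffunP=> i; rewrite [LHS]ffunE [X in X + _]ffunE [RHS]ffunE QpE NpE.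
rewrite [Jp _ _]ffunE natr_p opprK.
have -> : (1 : cyc k.+1) i = (i == 0)%:R.
  by rewrite ffunE -(inj_eq val_inj) /=; case: ifP.
case: (legP i) => [->|l|l].
- by rewrite leg0 eqxx ![0 == _]eq_sym oppr_eq0 oner_eq0 !addr0.
- rewrite l eqxx (negbTE (@leg_pm1 false _ l)) [1 == _]eq_sym (negbTE N1_neq1).
  by rewrite addr0 add0r.
- by rewrite l eqxx (negbTE (@leg_pm1 true _ l)) (negbTE N1_neq1) !add0r.
Qed.

(** -J is the all-one vector, and its product with Q is constant, equal to the number m = 4r - 1 =
    -1 of residues. *)
Lemma mulQJ : Q * J = - J.
Proof.
rewrite -[J]opprK -sumQN mulrN; congr (- _).
have J1 i : (1 + Q + N) i = 1.
  by rewrite sumQN [LHS]ffunE [Jp _ _]ffunE natr_p opprK.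
apply/ffunP=> x; rewrite [LHS]pmulE [RHS]ffunE J1.
under eq_bigr => i _ do rewrite J1 mulr1 QpE.
rewrite -natr_sum -big_mkcond sum1dep_card.
by have := card_leg false; rewrite expr0 => ->; rewrite mE (natr_pred4 R_mulr4n).
Qed.

(** The image of [sqr_Qp] under mu_{-1}, which swaps Q and N. *)
Lemma sqr_Np : N * N = N *+ (2 * r - 1) + Q *+ (2 * r).
Proof.
have [QN NQ] := mu_NR isNR_pred; have um := isNR_unit isNR_pred.
have := congr1 (mu k.+1) sqr_Qp.
by rewrite muM // muD // !muMn // QN NQ.
Qed.

Lemma mulQN : Q * N = J - Q - Q * Q.
Proof.
have -> : N = - J - Q - 1 by rewrite -sumQN; ring.
by rewrite !mulrBr mulrN mulQJ opprK mulr1; ring.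
Qed.

(* The Z_4 idempotents from which v and 1 - v assemble the generators of D1, D2. *)
Definition idemQ : cyc k.+1 := if odd r then Q + N *+ 2 else - Q.
Definition idemN : cyc k.+1 := if odd r then N + Q *+ 2 else - N.

Lemma JE : J = - (1 + Q + N). Proof. by rewrite sumQN opprK. Qed.

(** Only 2r modulo 4 matters in the formula for Q^2: it is 2 for odd r, giving Q^2 = Q + 2N, and 0
    for even r, giving Q^2 = -Q; likewise for N. *)
Lemma idemQN : [/\ idemQ * idemQ = idemQ, idemN * idemN = idemN,
  idemQ * idemN = J & idemQ + idemN = 1 + J].
Proof.
have QQ : Q * Q = _ := sqr_Qp; have NN := sqr_Np; have QN := mulQN.
rewrite /idemQ /idemN; have [odd_r|even_r] := boolP (odd r).
  have Q1 : Q * Q = Q + N *+ 2.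
    rewrite QQ (_ : 2 * r - 1 = 4 * r./2 + 1)%N ?mulrn_add4; last lia.
    by rewrite (_ : 2 * r = 4 * r./2 + 2)%N ?mulrn_add4 ?mulr1n //; lia.
  have N1 : N * N = N + Q *+ 2.
    rewrite NN (_ : 2 * r - 1 = 4 * r./2 + 1)%N ?mulrn_add4; last lia.
    by rewrite (_ : 2 * r = 4 * r./2 + 2)%N ?mulrn_add4 ?mulr1n //; lia.
  have Q0 := cyc_mulr4n Q; have N0 := cyc_mulr4n N; have QN0 := cyc_mulr4n (Q * N).
  split.
  (* Here and below, the expansion is arranged to isolate the multiples of 4, which vanish. *)
  - transitivity (Q * Q + (Q * N) *+ 4 + (N * N) *+ 4); first ring.
    by rewrite !cyc_mulr4n !addr0 Q1.
  - transitivity (N * N + (Q * N) *+ 4 + (Q * Q) *+ 4); first ring.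
    by rewrite !cyc_mulr4n !addr0 N1.
  - transitivity (Q * N + (Q * N) *+ 4 + (Q * Q) *+ 2 + (N * N) *+ 2); first ring.
    rewrite QN0 QN Q1 N1; transitivity (J + Q *+ 4 + N *+ 4); first ring.
    by rewrite Q0 N0 !addr0.
  - transitivity (Q *+ 4 + N *+ 4 - Q - N); first ring.
    by rewrite Q0 N0 JE; ring.
have Q1 : Q * Q = - Q.
  rewrite QQ (_ : 2 * r - 1 = 4 * r./2 - 1)%N ?mulrn_pred4; try lia.
  by rewrite (_ : 2 * r = 4 * r./2 + 0)%N ?mulrn_add4 ?addr0 //; lia.
have N1 : N * N = - N.
  rewrite NN (_ : 2 * r - 1 = 4 * r./2 - 1)%N ?mulrn_pred4; try lia.
  by rewrite (_ : 2 * r = 4 * r./2 + 0)%N ?mulrn_add4 ?addr0 //; lia.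
by split; rewrite ?mulrNN // ?Q1 ?N1 ?QN ?Q1 ?JE; ring.
Qed.

Lemma mu_QR_idem a : isQR k.+2 a -> mu a idemQ = idemQ /\ mu a idemN = idemN.
Proof.
move=> a_qr; have ua := isQR_unit a_qr; have [muQ muNp] := mu_QR a_qr.
by rewrite /idemQ /idemN; case: ifP => _; rewrite ?muD // ?muMn // ?muN // muQ muNp.
Qed.

Lemma mu_NR_idem a : isNR k.+2 a -> mu a idemQ = idemN /\ mu a idemN = idemQ.
Proof.
move=> a_nr; have ua := isNR_unit a_nr; have [muQ muNp] := mu_NR a_nr.
by rewrite /idemQ /idemN; case: ifP => _; rewrite ?muD // ?muMn // ?muN // muQ muNp.
Qed.

(* The element of R_p with components f at v = 1 and g at v = 0. *)
Definition crt (f g : cyc k.+1) : cyc k.+1 :=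
  (scal vR f : cyc k.+1) + scal (1 - vR) g.

Let V : cyc k.+1 := scal vR (1 : cyc k.+1).

Lemma crtE f g : crt f g = V * f + (1 - V) * g.
Proof.
rewrite /crt scal_mul [scal _ g]scal_mul; congr (_ + _ * _).
by apply/ffunP=> i; rewrite ffunE mulrBl mul1r [RHS]ffunE [(- V) i]ffunE [V i]ffunE.
Qed.

Lemma VV : V * V = V.
Proof.
rewrite /V -scal_mul; apply/ffunP=> i; rewrite !ffunE mulrA; congr (_ * _).
by apply/eqP.
Qed.

Lemma mu_crt a f g : (a%:R : 'Z_k.+2) \is a GRing.unit ->
  mu a (crt f g) = crt (mu a f) (mu a g).
Proof. by move=> ua; rewrite muD // !mu_scal. Qed.

(** V and 1 - V are orthogonal idempotents: the cross terms carry the factor V - V^2 = 0. *)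
Lemma crtM f g f' g' : crt f g * crt f' g' = crt (f * f') (g * g').
Proof.
rewrite !crtE; transitivity (V * V * (f * f') + (V - V * V) * (f * g' + g * f')
   + (1 - V - V + V * V) * (g * g')); first ring.
by rewrite VV; ring.
Qed.

Lemma crtD f g f' g' : crt f g + crt f' g' = crt (f + f') (g + g').
Proof. by rewrite !crtE; ring. Qed.

Lemma crtxx f : crt f f = f.
Proof. by rewrite crtE; ring. Qed.

Let d1 := crt idemQ idemN.
Let d2 := crt idemN idemQ.

Lemma d_idem : [/\ d1 * d1 = d1, d2 * d2 = d2, d1 * d2 = J & d1 + d2 = 1 + J].
Proof.
have [qq nn qn s] := idemQN.
by split; rewrite ?crtM ?crtD ?qq ?nn ?[idemN * _]mulrC ?qn ?[idemN + _]addrC ?s ?crtxx.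
Qed.

Lemma D1E : D1 k.+2 = gen d1.
Proof.
rewrite /D1 -/r /d1 /idemQ /idemN; case: ifP => // _; congr gen.
by apply/ffunP=> i; rewrite !ffunE !mulrN.
Qed.

Lemma D2E : D2 k.+2 = gen d2.
Proof.
rewrite /D2 -/r /d2 /idemQ /idemN; case: ifP => // _; congr gen.
by apply/ffunP=> i; rewrite !ffunE !mulrN.
Qed.

Lemma one_crt f g : 1 - crt f g = crt (1 - f) (1 - g).
Proof. by rewrite !crtE; ring. Qed.

(** The index switches because the v-part of the generator, 1 - N + 2Q or 1 + N, is the complement
    of [idemN], the v-part of d2. *)
Lemma E1E : E1 k.+2 = gen (1 - d2).
Proof.
rewrite /E1 -/r one_crt /idemQ /idemN; case: ifP => _; last by rewrite !opprK.
by rewrite !subrD2.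
Qed.

Lemma E2E : E2 k.+2 = gen (1 - d1).
Proof.
rewrite /E2 -/r one_crt /idemQ /idemN; case: ifP => _; last by rewrite !opprK.
by rewrite !subrD2.
Qed.

(** J is the constant -1, so g J is constant with value minus the coefficient sum of g; the ideal
    consists of the constant vectors, one for each element of R. *)
Lemma card_genJ : #|gen J| = 16.
Proof.
have mulJ (g : cyc k.+1) i : (g * J) i = - \sum_j g j.
  rewrite [LHS]pmulE -mulrN1 mulr_suml; apply: eq_bigr => j _.
  by rewrite [J _]ffunE natr_p.
have -> : gen J = (fun c : R => [ffun=> c]) @: [set: R].
  apply/setP=> x; apply/imsetP/imsetP=> [[g _ ->]|[c _ ->]].
    exists (- \sum_j g j) => //; apply/ffunP=> i; rewrite [RHS]ffunE; exact: mulJ.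
  (* The constant polynomial -c has coefficient sum -c, and J reverses the sign. *)
  exists [ffun i => if i == 0 then - c else 0] => //; apply/ffunP=> i.
  rewrite [RHS]mulJ ffunE (bigD1 0) //= big1 => [|j j0]; first by rewrite ffunE addr0 opprK.
  by rewrite ffunE (negbTE j0).
rewrite card_imset ?cardsT ?card_prod ?card_ord // => c c' /ffunP/(_ 0).
by rewrite !ffunE.
Qed.

(** Packs the arithmetic of residues into identities between two idempotents, from which the codes
    are then handled algebraically. *)
Lemma qr_idempotents : exists d1 d2 : cyc k.+1,
  [/\ [/\ d1 * d1 = d1, d2 * d2 = d2, d1 * d2 = J & d1 + d2 = 1 + J],
      forall a, isQR k.+2 a -> mu a d1 = d1 /\ mu a d2 = d2,
      forall a, isNR k.+2 a -> mu a d1 = d2 /\ mu a d2 = d1,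
      D1 k.+2 = gen d1 /\ D2 k.+2 = gen d2
    & E1 k.+2 = gen (1 - d2) /\ E2 k.+2 = gen (1 - d1)].
Proof.
exists d1, d2; split; [exact: d_idem| | |by rewrite D1E D2E|by rewrite E1E E2E].
  move=> a a_qr; have [qq nn] := mu_QR_idem a_qr.
  by rewrite !mu_crt ?qq ?nn // isQR_unit.
move=> a a_nr; have [qn nq] := mu_NR_idem a_nr.
by rewrite !mu_crt ?qn ?nq // isNR_unit.
Qed.

End Residues.

(** * The six assertions, by idempotent algebra *)

Theorem theorem18 (p : nat) (hp : prime p) (hp8 : (p %% 8 = 7)%N) :
  (* (i) *)
  (forall a : nat, isQR p a ->
     [/\ muS a (D1 p) = D1 p, muS a (D2 p) = D2 p,
         muS a (E1 p) = E1 p & muS a (E2 p) = E2 p]) /\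
  (forall a : nat, isNR p a ->
     muS a (D1 p) = D2 p /\ muS a (E1 p) = E2 p) /\
  (* (ii) *)
  (D1 p :&: D2 p = gen (Jp p) /\ sumC (D1 p) (D2 p) = [set: Rp p]) /\
  (* (iii) *)
  (E1 p :&: E2 p = [set (0 : Rp p)] /\ sumC (E1 p) (E2 p) = dual (gen (Jp p))) /\
  (* (iv) *)
  [/\ #|D1 p| = (4 ^ (p + 1))%N, #|D2 p| = (4 ^ (p + 1))%N,
      #|E1 p| = (4 ^ (p - 1))%N & #|E2 p| = (4 ^ (p - 1))%N] /\
  (* (v) *)
  (D1 p = sumC (E1 p) (gen (Jp p)) /\ D2 p = sumC (E2 p) (gen (Jp p))) /\
  (* (vi) *)
  [/\ E1 p \subset dual (E1 p), E2 p \subset dual (E2 p),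
      dual (E1 p) = D1 p & dual (E2 p) = D2 p].
Proof.
case: p hp hp8 => [|[|k]] // hp hp8.
have [d1 [d2 [[dd1 dd2 d12 d1D2] fixd swapd [-> ->] [-> ->]]]] :=
  qr_idempotents hp hp8.
have cardJ := card_genJ hp hp8.
set J : cyc k.+1 := Jp k.+2 in d12 d1D2 cardJ *.
have d1E : d1 = 1 + J - d2 by rewrite -d1D2 addrK.
have d2E : d2 = 1 + J - d1 by rewrite -d1D2 addrC addKr.
have d1J : d1 * J = J by rewrite -d12 mulrA dd1.
have d2J : d2 * J = J by rewrite -d12 mulrCA dd2.
have JJ : J * J = J by rewrite -{1}d12 -mulrA d2J d1J.
pose e1 := 1 - d2; pose e2 := 1 - d1; rewrite -/e1 -/e2.
have idemC (d : cyc k.+1) : d * d = d -> (1 - d) * (1 - d) = 1 - d.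
  by move=> dd; rewrite mulrBl mul1r mulrBr mulr1 dd subrr subr0.
have ee1 : e1 * e1 = e1 by exact: idemC.
have ee2 : e2 * e2 = e2 by exact: idemC.
have e1J : e1 * J = 0 by rewrite mulrBl mul1r d2J subrr.
have e2J : e2 * J = 0 by rewrite mulrBl mul1r d1J subrr.
have e12 : e1 * e2 = 0.
  transitivity (1 - (d1 + d2) + d1 * d2); first by rewrite /e1 /e2; ring.
  by rewrite d1D2 d12; ring.
have e1D : e1 + J = d1 by rewrite d1E /e1; ring.
have e2D : e2 + J = d2 by rewrite d2E /e2; ring.
have e1De2 : e1 + e2 = 1 - J by rewrite /e1 /e2 d1E; ring.
have mu1B a (d : cyc k.+1) : (a%:R : 'Z_k.+2) \is a GRing.unit ->
    (mu a (1 - d) : cyc k.+1) = 1 - (mu a d : cyc k.+1).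
  by move=> ua; rewrite muD // muN // mu1.
have nrN : isNR k.+2 k.+1 := isNR_pred hp hp8.
have um := isNR_unit hp hp8 nrN; have [muN12 muN21] := swapd _ nrN.
have muSE a (f : cyc k.+1) : (a%:R : 'Z_k.+2) \is a GRing.unit ->
  muS a (gen f) = gen (mu a f) by move=> ua; exact: muS_gen.
have gen1 : gen (1 : cyc k.+1) = [set: Rp k.+2].
  by apply/setP=> x; rewrite mem_gen ?mulr1 // eqxx inE.
have gen0 : gen (0 : cyc k.+1) = [set (0 : Rp k.+2)].
  by apply/setP=> x; rewrite mem_gen ?mulr0 // inE eq_sym.
(* mu_{-1} sends e1 = 1 - d2 to 1 - d1, whose complement is d1. *)
have dualE1 : dual (gen e1) = gen d1.
  by rewrite dual_gen // mu1B // muN21 subKr.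
have dualE2 : dual (gen e2) = gen d2.
  by rewrite dual_gen // mu1B // muN12 subKr.
(* The injective map mu_{-1} carries (d1) onto (d2). *)
have cardD12 : #|gen d1| = #|gen d2|.
  by rewrite -muN12 -muSE // [RHS]card_imset //; apply: mu_inj um.
have cardD1 : #|gen d1| = (#|gen e1| * 16)%N.
  by rewrite -e1D card_gen_add // cardJ.
have cardD2 : #|gen d2| = (#|gen e2| * 16)%N.
  by rewrite -e2D card_gen_add // cardJ.
have cardE12 : #|gen e1| = #|gen e2|.
  by apply/eqP; rewrite -(eqn_pmul2r (isT : 0 < 16)%N) -cardD1 -cardD2 cardD12.
(* R_p is the direct sum of (d1) and (e2), so 16^p = 16 |E1| |E2| = 16 |E2|^2, and |E2| is the
   square root of 16^(p-1). *)
have cardE2 : #|gen e2| = (4 ^ k.+1)%N.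
  have : #|gen (1 : cyc k.+1)| = (16 ^ k.+2)%N.
    by rewrite gen1 cardsT card_ffun card_prod !card_ord.
  rewrite -[1](subrKC d1) card_gen_add // ?mulrBr ?mulr1 ?dd1 ?subrr //.
  rewrite -/e2 cardD1 cardE12 mulnAC expnSr => /eqP.
  rewrite eqn_pmul2r // -[16%N]/(4 ^ 2)%N -expnM mulnC expnM mulnn eqn_exp2r //.
  by move/eqP.
have cardE1 : #|gen e1| = (4 ^ k.+1)%N by rewrite cardE12.
have card_D : (4 ^ k.+1 * 16 = 4 ^ (k.+2 + 1))%N by rewrite addn1 -[16%N]/(4 ^ 2)%N -expnD addn2.
split.
  move=> a a_qr; have ua := isQR_unit hp hp8 a_qr; have [m1 m2] := fixd _ a_qr.
  by rewrite !muSE // !mu1B // m1 m2.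
split.
  move=> a a_nr; have ua := isNR_unit hp hp8 a_nr; have [m1 m2] := swapd _ a_nr.
  by rewrite !muSE // mu1B // m2 m1.
split.
  rewrite genI // sumC_gen // d12; split=> //.
  by rewrite d1D2 addrK gen1.
split.
  rewrite genI // sumC_gen // e12; split=> //.
  rewrite dual_gen // subr0; congr gen.
  (* mu_{-1} swaps the factors of J = d1 d2, so the dual of (J) is (1 - J). *)
  have mJ : mu k.+1 J = J by rewrite -d12 muM // muN12 muN21 mulrC.
  by rewrite mJ e1De2.
split.
  by rewrite subn1 cardD1 cardD2 cardE1 cardE2 card_D.
split.
  by rewrite !sumC_gen // e1J e2J !subr0 e1D e2D.
(* With the duals known, self-orthogonality is the inclusion of (e_i) in (d_i), which follows from
   e_i d_i = e_i (e_i + J) = e_i. *)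
rewrite dualE1 dualE2; split=> //; apply: subset_gen => //.
  by rewrite -e1D mulrDr ee1 e1J addr0.
by rewrite -e2D mulrDr ee2 e2J addr0.
Qed.
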